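(* Let $A\in\mathcal{V}$ and let $\theta$ be a congruence of $A$ with $\theta\subseteq Rad(A)$. If $\theta$ has $CBLP$, then every set $\Omega'$ of atoms of the Boolean algebra $B(Con(A/\theta))$ is lifted by $p_\theta$ to a unique subset $\Omega$ of $B(Con(A))$, and $\Omega$ consists of atoms of $B(Con(A))$.
   Context: $\mathcal{V}$ is a congruence modular, semidegenerate variety (no nontrivial algebra has a one-element subalgebra) of finite signature, such that for every $B\in\mathcal{V}$ the set $K(B)$ of compact congruences is closed under the Freese–McKenzie commutator. $Con(A)$ is the congruence lattice with bounds $\Delta_A,\nabla_A$; $Rad(A)$ is the intersection of all maximal congruences of $A$; $B(Con(A))$ is the Boolean algebra of complemented elements of $Con(A)$. $p_\theta:A\to A/\theta$ is the canonical surjection, and $p_\theta^{\bullet}(\alpha)=(\alpha\vee\theta)/\theta$ for $\alpha\in Con(A)$; it restricts to a Boolean morphism $B(Con(A))\to B(Con(A/\theta))$. $p_\theta$ lifts $\Omega'\subseteq Con(A/\theta)$ to $\Omega\subseteq Con(A)$ if $\Omega'=\{p_\theta^{\bullet}(\alpha):\alpha\in\Omega\}$. The congruence $\theta$ has $CBLP$ if for every $\beta\in B(Con(A/\theta))$ there exists $\alpha\in B(Con(A))$ with $(\alpha\vee\theta)/\theta=\beta$. *)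

(* Defs.v *)
From Stdlib Require Import ClassicalEpsilon.
From mathcomp Require Import all_boot.

Unset Printing Implicit Defensive.

Record signature := Signature { op_sym : finType; arity : op_sym -> nat }.
Arguments arity {s} f : rename.

Record algebra (S : signature) := Algebra {
  carrier :> Type;
  interp : forall f : op_sym S, ('I_(arity f) -> carrier) -> carrier }.
Arguments interp {S} a f : rename.

Inductive term (S : signature) (X : Type) : Type :=
| Var : X -> term S X
| App : forall f : op_sym S, ('I_(arity f) -> term S X) -> term S X.
Arguments Var {S X} x.
Arguments App {S X} f ts : rename.

Fixpoint eval {S : signature} {X : Type} {A : algebra S} (v : X -> A)
  (t : term S X) : A :=
  match t with
  | Var x => v x
  | App f ts => interp A f (fun i => eval v (ts i))
  end.

(* Varieties = equational classes (Birkhoff): given by a set E of identities. *)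
Definition identity (S : signature) := (term S nat * term S nat)%type.
Definition satisfies {S : signature} (A : algebra S) (e : identity S) :=
  forall v : nat -> A, eval v e.1 = eval v e.2.
Definition in_variety {S : signature} (E : identity S -> Prop) (A : algebra S) :=
  forall e, E e -> satisfies A e.

Definition crel (T : Type) := T -> T -> Prop.
Definition csubrel {T : Type} (r s : crel T) := forall x y, r x y -> s x y.

Definition is_cong {S : signature} (A : algebra S) (r : crel A) :=
  [/\ (forall x, r x x), (forall x y, r x y -> r y x),
      (forall x y z, r x y -> r y z -> r x z) &
      (forall f (a b : 'I_(arity f) -> A),
          (forall i, r (a i) (b i)) -> r (interp A f a) (interp A f b))].

Definition cdelta {S : signature} (A : algebra S) : crel A := fun x y => x = y.
Definition cnabla {S : signature} (A : algebra S) : crel A := fun _ _ => True.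

Definition cg {S : signature} (A : algebra S) (R : crel A) : crel A :=
  fun x y => forall th, is_cong A th -> csubrel R th -> th x y.
Definition cjoin {S : signature} (A : algebra S) (a b : crel A) : crel A :=
  cg A (fun x y => a x y \/ b x y).
Definition cmeet {S : signature} {A : algebra S} (a b : crel A) : crel A :=
  fun x y => a x y /\ b x y.
Definition cbigjoin {S : signature} (A : algebra S) (F : crel A -> Prop) : crel A :=
  cg A (fun x y => exists b, F b /\ b x y).

Definition Bcon {S : signature} (A : algebra S) (a : crel A) :=
  is_cong A a /\ exists b, is_cong A b /\
    cjoin A a b = cnabla A /\ cmeet a b = cdelta A.

Definition B_atom {S : signature} (A : algebra S) (a : crel A) :=
  [/\ Bcon A a, a <> cdelta A &
      forall b, Bcon A b -> csubrel b a -> b = cdelta A \/ b = a].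

Definition max_cong {S : signature} (A : algebra S) (m : crel A) :=
  [/\ is_cong A m, m <> cnabla A &
      forall b, is_cong A b -> csubrel m b -> b = m \/ b = cnabla A].
Definition Rad {S : signature} (A : algebra S) : crel A :=
  fun x y => forall m, max_cong A m -> m x y.

Definition compact {S : signature} (A : algebra S) (a : crel A) :=
  is_cong A a /\
  forall F : crel A -> Prop, (forall b, F b -> is_cong A b) ->
    csubrel a (cbigjoin A F) ->
    exists l : list (crel A), (forall b, List.In b l -> F b) /\
      csubrel a (cbigjoin A (fun b => List.In b l)).

(* Term-condition centrality C(a,b;d) and the Freese--McKenzie commutator
   [a,b] = least congruence d with C(a,b;d). *)
Definition env {T : Type} (u w : nat -> T) : nat + nat -> T :=
  fun s => match s with inl i => u i | inr j => w j end.
Definition centralizes {S : signature} {A : algebra S} (a b d : crel A) :=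
  forall (t : term S (nat + nat)) (x y c e : nat -> A),
    (forall i, a (x i) (y i)) -> (forall i, b (c i) (e i)) ->
    d (eval (env x c) t) (eval (env x e) t) ->
    d (eval (env y c) t) (eval (env y e) t).
Definition commutator {S : signature} (A : algebra S) (a b : crel A) : crel A :=
  fun x y => forall d, is_cong A d -> centralizes a b d -> d x y.

Definition cm_variety {S : signature} (E : identity S -> Prop) :=
  forall B : algebra S, in_variety E B ->
  forall a b c : crel B, is_cong B a -> is_cong B b -> is_cong B c ->
    csubrel a c -> cjoin B a (cmeet b c) = cmeet (cjoin B a b) c.
Definition semidegenerate {S : signature} (E : identity S -> Prop) :=
  forall B : algebra S, in_variety E B ->
  forall b : B, (forall f, interp B f (fun _ => b) = b) ->
  forall x y : B, x = y.
Definition compact_comm_closed {S : signature} (E : identity S -> Prop) :=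
  forall B : algebra S, in_variety E B ->
  forall a b : crel B, compact B a -> compact B b -> compact B (commutator B a b).

Section Quotient.
Variables (S : signature) (A : algebra S) (th : crel A).
Definition qcarrier := {P : A -> Prop | exists a, P = th a}.
Definition cls (a : A) : qcarrier := exist _ (th a) (ex_intro _ a erefl).
Definition rep (X : qcarrier) : A :=
  proj1_sig (constructive_indefinite_description _ (proj2_sig X)).
Definition quot : algebra S :=
  @Algebra S qcarrier (fun f args => cls (interp A f (fun i => rep (args i)))).
(* p_th : A -> A/th is cls; p_th^bullet(a) = (a \/ th)/th *)
Definition p_bullet (a : crel A) : crel quot :=
  fun X Y => exists x y, X = cls x /\ Y = cls y /\ cjoin A a th x y.
End Quotient.
Arguments cls {S A} th a.
Arguments p_bullet {S A} th a _ _.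
Arguments quot {S} A th.

Definition CBLP {S : signature} (A : algebra S) (th : crel A) :=
  forall b, Bcon (quot A th) b -> exists a, Bcon A a /\ p_bullet th a = b.

Definition lifts {S : signature} (A : algebra S) (th : crel A)
  (Om : crel A -> Prop) (Om' : crel (quot A th) -> Prop) :=
  forall b, Om' b <-> exists a, Om a /\ p_bullet th a = b.

(* Main.v *)
(** The theorem reduces to two facts about the map [p_bullet th] on complemented
    congruences: it preserves complements, and it is injective when [th] is
    below the radical.

    Both rest on the identity [(al v th) ^ (be v th) = th] for complementary
    [al], [be].  Put [x := (al v th) ^ (be v th)] and view [x] as a subalgebra of
    [A^2].  Consider the "matrices" relating [(p, q)] to [(r, s)] when
    [p al r], [q al s] and [(p, r), (q, s)] are related by the join of the
    congruences induced by [be] and [th] on the subalgebra [al] of [A^2].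
    Modularity on that subalgebra, together with the shifting lemma in [A], shows
    that if [p th q] then [r th s].  The matrices for [al] and those for [be]
    generate a congruence on [x] for which, as [al v be] is total, the diagonal
    lies in one class; by semidegeneracy this congruence is total, so every pair
    in [x] lies in [th].

    For injectivity one also needs that proper congruences extend to maximal
    ones: by semidegeneracy the total congruence is generated by the finitely many
    pairs [(f(e, .., e), e)]. *)

Require Import Defs.
From Stdlib Require Import ClassicalEpsilon Relation_Operators.
From mathcomp Require Import all_boot boolp.
From mathcomp Require classical_sets.

(** * Joins, meets and pullbacks of congruences *)

Section CongruenceLattice.
Context {S : signature}.
Implicit Types A B : algebra S.

Lemma crel_ext T (r s : crel T) : csubrel r s -> csubrel s r -> r = s.
Proof.
move=> rs sr; apply: funext => x; apply: funext => y; apply: propext.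
by split; [exact: rs | exact: sr].
Qed.

Lemma cg_cong {A} (R : crel A) : is_cong A (cg A R).
Proof.
split.
- by move=> x t [].
- by move=> x y h t ct Rt; case: (ct) => _ sy _ _; apply: sy; exact: h.
- move=> x y z h k t ct Rt; case: (ct) => _ _ tr _.
  by apply: (tr _ y); [exact: h | exact: k].
- move=> f a b h t ct Rt; case: (ct) => _ _ _ cp.
  by apply: cp => i; exact: h.
Qed.

Lemma cjoin_cong {A} (a b : crel A) : is_cong A (cjoin A a b).
Proof. exact: cg_cong. Qed.

Lemma cjoinl {A} (a b : crel A) : csubrel a (cjoin A a b).
Proof. by move=> x y h t ct; apply; left. Qed.

Lemma cjoinr {A} (a b : crel A) : csubrel b (cjoin A a b).
Proof. by move=> x y h t ct; apply; right. Qed.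

Lemma cjoin_min {A} (a b t : crel A) : is_cong A t ->
  csubrel a t -> csubrel b t -> csubrel (cjoin A a b) t.
Proof. by move=> ct a_t b_t x y; apply=> // u v [/a_t|/b_t]. Qed.

Lemma cjoinC {A} (a b : crel A) : cjoin A a b = cjoin A b a.
Proof.
by apply: crel_ext; apply: cjoin_min;
  [exact: cjoin_cong | exact: cjoinr | exact: cjoinl
  |exact: cjoin_cong | exact: cjoinr | exact: cjoinl].
Qed.

Lemma cmeetC {A} (a b : crel A) : cmeet a b = cmeet b a.
Proof. by apply: crel_ext => x y []. Qed.

Lemma cmeet_cong {A} (a b : crel A) :
  is_cong A a -> is_cong A b -> is_cong A (cmeet a b).
Proof.
case=> ra sa ta ca [rb sb tb cb]; split.
- by split.
- by move=> x y [/sa ? /sb].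
- move=> x y z [h1 h2] [k1 k2]; split; [exact: ta h1 k1 | exact: tb h2 k2].
- by move=> f u v h; split; [apply: ca | apply: cb] => i; case: (h i).
Qed.

Lemma cdelta_cong {A} : is_cong A (cdelta A).
Proof.
split; rewrite /cdelta => //; first by move=> x y z ->.
by move=> f a b h; congr (interp _ _); apply: funext.
Qed.

Lemma cnabla_cong {A} : is_cong A (cnabla A).
Proof. by split. Qed.

Lemma Bcon_cdelta {A} : Bcon A (cdelta A).
Proof.
split; first exact: cdelta_cong.
exists (cnabla A); split; first exact: cnabla_cong.
split; apply: crel_ext => //; last by move=> x y [].
by move=> x y _; exact: cjoinr.
Qed.

Definition is_hom {A B} (h : A -> B) :=
  forall f (a : 'I_(arity f) -> A), h (interp A f a) = interp B f (h \o a).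

Lemma preimage_cong {A B} (h : A -> B) (t : crel B) :
  is_hom h -> is_cong B t -> is_cong A (fun x y => t (h x) (h y)).
Proof.
move=> hh [rt st tt ct]; split=> //.
- by move=> x y /st.
- by move=> x y z; exact: tt.
- by move=> f a b ab; rewrite !hh; exact: ct.
Qed.

Lemma eval_hom {A B} (h : A -> B) : is_hom h ->
  forall X (v : X -> A) (t : term S X), h (eval v t) = eval (h \o v) t.
Proof.
move=> hh X v; elim=> [//|f ts IH] /=.
by rewrite hh; congr (interp _ _); apply: funext => i; exact: IH.
Qed.

(* The rewriting of a tuple along [R]-chains is done one argument at a time. *)
Lemma clos_refl_trans_cong {A} (R : crel A) :
    (forall x y, R x y -> R y x) ->
    (forall f (a b : 'I_(arity f) -> A) j,
       (forall i, i != j -> a i = b i) -> R (a j) (b j) ->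
       R (interp A f a) (interp A f b)) ->
  is_cong A (clos_refl_trans A R).
Proof.
move=> symR cR; split.
- by move=> x; exact: rt_refl.
- move=> x y; elim=> [u v /symR|u|u v w _ h1 _ h2]; first exact: rt_step.
    exact: rt_refl.
  exact: rt_trans h2 h1.
- by move=> x y z; exact: rt_trans.
move=> f a b ab.
pose hyb k := fun i : 'I_(arity f) => if (i < k)%N then b i else a i.
suff hk k : clos_refl_trans A R (interp A f a) (interp A f (hyb k)).
  have -> : b = hyb (arity f) by apply: funext => i; rewrite /hyb ltn_ord.
  exact: hk.
elim: k => [|k IH].
  have -> : hyb 0 = a by apply: funext => i; rewrite /hyb ltn0.
  exact: rt_refl.
case: (ltnP k (arity f)) => [kf|fk]; last first.
  have -> : hyb k.+1 = hyb k; last exact: IH.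
  apply: funext => i; have ik := leq_trans (ltn_ord i) fk.
  by rewrite /hyb ik ltnS ltnW.
apply: (rt_trans _ _ _ _ _ IH); pose j := Ordinal kf.
pose upd c := fun i : 'I_(arity f) => if i == j then c else hyb k i.
have updE : hyb k = upd (a j).
  by apply: funext => i; rewrite /upd; case: eqP => // ->; rewrite /hyb /= ltnn.
have -> : hyb k.+1 = upd (b j).
  apply: funext => i; rewrite /upd; case: eqP => [->|/eqP ij].
    by rewrite /hyb /= ltnS leqnn.
  have {}ij : (i : nat) != k by [].
  by rewrite /hyb ltnS leq_eqVlt (negPf ij).
rewrite updE {updE}; elim: (ab j) => [u v uv|u|u v w _ h1 _ h2].
- apply: rt_step; apply: (cR f _ _ j) => [i ij|]; rewrite /upd ?(negPf ij) //.
  by rewrite eqxx.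
- exact: rt_refl.
- exact: rt_trans h1 h2.
Qed.

End CongruenceLattice.

(** * Quotient algebras and the map [p_bullet] *)

Section QuotientAlgebra.
Context {S : signature} {A : algebra S} {th : crel A} (Hth : is_cong A th).

Lemma cls_eq x y : cls th x = cls th y <-> th x y.
Proof.
case: Hth => r s t _; split=> [e|h].
  have /(congr1 (fun P => P y)) : th x = th y by case: e.
  by move=> ->.
apply: eq_exist; apply: funext => z; apply: propext; split; last exact: t.
by apply: t; exact: s.
Qed.

Lemma cls_rep (X : quot A th) : cls th (rep _ _ _ X) = X.
Proof.
case: X => P HP; apply: eq_exist; rewrite /rep /=.
by case: (ClassicalEpsilon.constructive_indefinite_description _ _).
Qed.

Lemma cls_hom : is_hom (A := A) (B := quot A th) (cls th).
Proof.
move=> f a; apply/cls_eq; case: Hth => _ s _; apply=> i.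
by apply/cls_eq; rewrite cls_rep.
Qed.

Lemma quot_in_variety (E : identity S -> Prop) :
  in_variety E A -> in_variety E (quot A th).
Proof.
move=> HA e Ee v.
have -> : v = cls th \o (fun i => rep _ _ _ (v i)).
  by apply: funext => i; rewrite /= cls_rep.
by rewrite -!(eval_hom (B := quot A th) _ cls_hom) (HA e Ee).
Qed.

(** Since [cjoin A a th] contains [th], the choice of representatives in [p_bullet] is
    immaterial. *)
Lemma p_bulletE (a : crel A) x y :
  p_bullet th a (cls th x) (cls th y) <-> cjoin A a th x y.
Proof.
split; last by move=> h; exists x, y.
case=> x' [y' [/cls_eq xx' [/cls_eq yy' h]]].
have [_ s t _] := cjoin_cong a th.
apply: (t _ _ _ (cjoinr _ _ _ _ xx')); apply: (t _ _ _ h).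
by apply: s; exact: cjoinr.
Qed.

Lemma quot_crel_ext (r s : crel (quot A th)) :
  (forall x y, r (cls th x) (cls th y) <-> s (cls th x) (cls th y)) -> r = s.
Proof.
by move=> rs; apply: crel_ext => X Y; rewrite -(cls_rep X) -(cls_rep Y) rs.
Qed.

Lemma p_bullet_cong (a : crel A) : is_cong (quot A th) (p_bullet th a).
Proof.
have [r s t c] := cjoin_cong a th; split.
- by move=> X; rewrite -(cls_rep X) p_bulletE.
- by move=> X Y; rewrite -(cls_rep X) -(cls_rep Y) !p_bulletE; exact: s.
- move=> X Y Z; rewrite -(cls_rep X) -(cls_rep Y) -(cls_rep Z) !p_bulletE.
  exact: t.
- move=> f u v h; apply/p_bulletE; apply: c => i.
  by apply/p_bulletE; rewrite !cls_rep.
Qed.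

Lemma p_bullet_cdelta : p_bullet th (cdelta A) = cdelta (quot A th).
Proof.
apply: quot_crel_ext => x y; rewrite p_bulletE.
have rth : forall x, th x x by case: Hth.
split=> [h|/cls_eq]; last exact: cjoinr.
by apply/cls_eq; move: h; apply: cjoin_min => // u v ->.
Qed.

Lemma p_bullet_mono (a b : crel A) :
  csubrel a b -> csubrel (p_bullet th a) (p_bullet th b).
Proof.
move=> ab X Y; rewrite -(cls_rep X) -(cls_rep Y) !p_bulletE.
apply: cjoin_min; [exact: cjoin_cong | | exact: cjoinr].
by move=> x y /ab; exact: cjoinl.
Qed.

Lemma p_bullet_inj_cjoin (a b : crel A) :
  p_bullet th a = p_bullet th b -> cjoin A a th = cjoin A b th.
Proof.
by move=> e; apply: crel_ext => x y; rewrite -!p_bulletE e.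
Qed.

(** The pullback along [cls] of the join in the quotient is a congruence above [a] and [b]. *)
Lemma p_bullet_cjoin_cnabla (a b : crel A) : cjoin A a b = cnabla A ->
  cjoin (quot A th) (p_bullet th a) (p_bullet th b) = cnabla (quot A th).
Proof.
move=> ab; apply: crel_ext => // X Y _; rewrite -(cls_rep X) -(cls_rep Y).
set r := cjoin _ _ _.
have cr : is_cong A (fun x y => r (cls th x) (cls th y)).
  exact: (preimage_cong (B := quot A th) _ _ cls_hom (cjoin_cong _ _)).
have : cjoin A a b (rep _ _ _ X) (rep _ _ _ Y) by rewrite ab.
apply: (cjoin_min _ _ _ cr) => x y h; [apply: cjoinl | apply: cjoinr];
  by apply/p_bulletE; exact: cjoinl.
Qed.

End QuotientAlgebra.

(** * A congruence as a subalgebra of the square *)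

Section PairAlgebra.
Context {S : signature} {A : algebra S} {r : crel A} (Hr : is_cong A r).

Definition pair_carrier := {p : A * A | r p.1 p.2}.

Lemma interp_pair f (u : 'I_(arity f) -> pair_carrier) :
  r (interp A f (fun i => (sval (u i)).1), interp A f (fun i => (sval (u i)).2)).1
    (interp A f (fun i => (sval (u i)).1), interp A f (fun i => (sval (u i)).2)).2.
Proof. by case: Hr => _ _ _; apply => i; exact: (svalP (u i)). Qed.

Definition pair_alg : algebra S :=
  @Algebra S pair_carrier (fun f u => exist _ _ (interp_pair f u)).

Definition mkpair (p q : A) (h : r p q) : pair_alg :=
  exist (fun p : A * A => r p.1 p.2) (p, q) h.

Definition pfst (X : pair_alg) : A := (sval X).1.
Definition psnd (X : pair_alg) : A := (sval X).2.

Lemma pair_ext (X Y : pair_alg) : pfst X = pfst Y -> psnd X = psnd Y -> X = Y.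
Proof.
case: X Y => [[p q] h] [[p' q'] h']; rewrite /pfst /psnd /= => e1 e2.
by apply: eq_exist; rewrite e1 e2.
Qed.

Lemma pfst_hom : is_hom pfst. Proof. by []. Qed.
Lemma psnd_hom : is_hom psnd. Proof. by []. Qed.

Lemma pair_in_variety (E : identity S -> Prop) :
  in_variety E A -> in_variety E pair_alg.
Proof.
move=> HA e Ee v; apply: pair_ext.
  by rewrite !(eval_hom _ pfst_hom) (HA e Ee).
by rewrite !(eval_hom _ psnd_hom) (HA e Ee).
Qed.

Definition plift (b : crel A) : crel pair_alg :=
  cmeet (fun X Y => b (pfst X) (pfst Y)) (fun X Y => b (psnd X) (psnd Y)).

Lemma plift_cong (b : crel A) : is_cong A b -> is_cong pair_alg (plift b).
Proof.
move=> cb; apply: cmeet_cong.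
  exact: preimage_cong pfst_hom cb.
exact: preimage_cong psnd_hom cb.
Qed.

End PairAlgebra.
Arguments pair_alg {S A r} Hr.
Arguments mkpair {S A r} Hr {p q} h.
Arguments plift {S A r} Hr b _ _.

(** * Shifting, matrices and complements in a modular variety *)

Section Modular.
Context {S : signature} {E : identity S -> Prop} (HCM : cm_variety E).
Context {A : algebra S} (HA : in_variety E A).

(** By modularity [((th ^ be) v al) ^ be = (th ^ be) v (al ^ be)], which lies below [th]; the path
    from [r] through [p] and [q] to [s] puts [(r, s)] in the left side. *)
Lemma shifting {al be th : crel A} {p q r s : A} :
    is_cong A al -> is_cong A be -> is_cong A th ->
    csubrel (cmeet al be) th ->
  be p q -> be r s -> al p r -> al q s -> th p q -> th r s.
Proof.
move=> cal cbe cth le pq rs pr qs tpq.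
have ctb := cmeet_cong _ _ cth cbe.
have := HCM A HA _ al _ ctb cal cbe (fun x y h => proj2 h).
move/(congr1 (fun R => R r s)) => e.
have [_ sy tr _] := cjoin_cong (cmeet th be) al.
have : cmeet (cjoin A (cmeet th be) al) be r s.
  split=> //; apply: (tr _ _ _ _ (cjoinr _ _ _ _ qs)).
  apply: (tr _ _ _ _ (cjoinl _ _ _ _ (conj tpq pq))).
  by apply: sy; exact: cjoinr.
by rewrite -e; apply: cjoin_min => // x y [].
Qed.

Section Matrices.
Context {al be th : crel A}.
Hypotheses (cal : is_cong A al) (cbe : is_cong A be) (cth : is_cong A th).

Definition matrix_cong : crel (pair_alg cal) :=
  cjoin (pair_alg cal) (plift cal th) (plift cal be).

(** Requiring [al p r] and [al q s] separately keeps the quantification over proofs in the last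
    clause from being vacuous. *)
Definition matrix (p q r s : A) :=
  [/\ al p r, al q s &
      forall (h : al p r) (k : al q s), matrix_cong (mkpair cal h) (mkpair cal k)].

(** The diagonal embedding of [A] into [al] pulls [matrix_cong] back to a congruence above [be] and
    [th]. *)
Lemma matrix_refl p q : cjoin A be th p q -> matrix p q p q.
Proof.
have ra : forall x, al x x by case: cal.
move=> pq; split=> // h k; pose diag x := mkpair cal (ra x).
have dh : is_hom (diag : A -> pair_alg cal) by move=> f a; exact: pair_ext.
rewrite (Prop_irrelevance h (ra p)) (Prop_irrelevance k (ra q)).
have cd := preimage_cong (diag : A -> pair_alg cal) _ dh (cjoin_cong _ _ : is_cong _ matrix_cong).
apply: (cjoin_min _ _ _ cd) pq => x y xy; [exact: cjoinr | exact: cjoinl].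
Qed.

Lemma matrix_diag p q : al p q -> matrix p p q q.
Proof.
move=> pq; split=> // h k; rewrite (Prop_irrelevance h k).
by case: (cjoin_cong (plift cal th) (plift cal be)) => refl _ _ _; exact: refl.
Qed.

(** Swapping coordinates is an endomorphism of the algebra [al] under which both generators of
    [matrix_cong] are stable. *)
Lemma matrix_sym p q r s : matrix p q r s -> matrix r s p q.
Proof.
have sa : forall x y, al x y -> al y x by case: cal.
case=> pr qs E0; split; try exact: sa.
move=> h k; pose sw (X : pair_alg cal) := mkpair cal (sa _ _ (svalP X : al (pfst cal X) (psnd cal X))).
have sh : is_hom (sw : pair_alg cal -> pair_alg cal) by move=> f a; exact: pair_ext.
have cs := preimage_cong sw _ sh (cjoin_cong _ _ : is_cong _ matrix_cong).
have -> : mkpair cal h = sw (mkpair cal pr) by exact: pair_ext.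
have -> : mkpair cal k = sw (mkpair cal qs) by exact: pair_ext.
apply: (cjoin_min _ _ _ cs) (E0 pr qs) => X Y [h1 h2].
  by apply: cjoinl; split.
by apply: cjoinr; split.
Qed.

Lemma matrix_interp f (p q r s : 'I_(arity f) -> A) :
  (forall i, matrix (p i) (q i) (r i) (s i)) ->
  matrix (interp A f p) (interp A f q) (interp A f r) (interp A f s).
Proof.
move=> H; have pr i : al (p i) (r i) by case: (H i).
have qs i : al (q i) (s i) by case: (H i).
have [_ _ _ ca] := cal; split; [exact: ca | exact: ca | move=> h k].
have -> : mkpair cal h = interp (pair_alg cal) f (fun i => mkpair cal (pr i)).
  exact: pair_ext.
have -> : mkpair cal k = interp (pair_alg cal) f (fun i => mkpair cal (qs i)).
  exact: pair_ext.
have [_ _ _] := cjoin_cong (plift cal th) (plift cal be).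
by apply=> i; case: (H i) => _ _; apply.
Qed.

(* This is the term condition for [al] against [be v th], modulo [th]. *)
Lemma matrix_th p q r s : csubrel (cmeet al be) (cdelta A) ->
  matrix p q r s -> th p q -> th r s.
Proof.
move=> ab [pr qs /(_ pr qs) E0] pq.
have rth : forall x, th x x by case: cth.
have ct0 := preimage_cong (pfst cal) _ (pfst_hom cal) cth.
have ct1 := preimage_cong (psnd cal) _ (psnd_hom cal) cth.
(* The modular law, with the kernel-like congruence [th] on first coordinates as upper bound, splits
   the pair into steps in [plift th] and steps in [plift be] with [th]-related first coordinates.
   The former preserve [th] on second coordinates by definition, the latter by shifting. *)
have := HCM _ (pair_in_variety cal E HA) _ _ _ (plift_cong cal _ cth)
  (plift_cong cal _ cbe) ct0 (fun X Y h => proj1 h).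
move/(congr1 (fun R => R (mkpair cal pr) (mkpair cal qs))) => e.
have : cmeet (cjoin (pair_alg cal) (plift cal th) (plift cal be))
    (fun X Y => th (pfst cal X) (pfst cal Y)) (mkpair cal pr) (mkpair cal qs).
  by split.
rewrite -e; apply: (cjoin_min _ _ _ ct1) => [X Y []//|X Y [[b1 b2] t1]].
apply: (shifting cal cbe cth _ b1 b2 (svalP X) (svalP Y) t1).
by move=> x y /ab ->.
Qed.

End Matrices.

Context (HSD : semidegenerate E).

(** The class of [e] is a one-element subalgebra of the quotient, which is therefore trivial. *)
Lemma idempotent_class_total {B : algebra S} (t : crel B) (e : B) :
    in_variety E B -> is_cong B t -> (forall f, t (interp B f (fun=> e)) e) ->
  forall x y, t x y.
Proof.
move=> HB ct te x y; apply/(cls_eq ct).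
apply: (HSD _ (quot_in_variety ct _ HB) (cls t e)) => f.
rewrite -[RHS]((cls_eq ct _ _).2 (te f)).
by rewrite (cls_hom ct f (fun=> e)).
Qed.

Lemma complemented_cjoin_cmeet {al be : crel A} (th : crel A) :
    is_cong A al -> is_cong A be -> is_cong A th ->
    cjoin A al be = cnabla A -> cmeet al be = cdelta A ->
  csubrel (cmeet (cjoin A al th) (cjoin A be th)) th.
Proof.
move=> cal cbe cth jab mab u v uv.
have rth : forall x, th x x by case: cth.
set x := cmeet _ _ in uv.
have cx : is_cong A x by exact: cmeet_cong (cjoin_cong _ _) (cjoin_cong _ _).
have rx : forall x0, x x0 x0 by case: cx.
pose B := pair_alg cx.
pose M (P Q : B) :=
  matrix (be := be) (th := th) cal (pfst cx P) (psnd cx P) (pfst cx Q) (psnd cx Q)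
  \/ matrix (be := al) (th := th) cbe (pfst cx P) (psnd cx P) (pfst cx Q) (psnd cx Q).
have Mth P Q : M P Q -> th (pfst cx P) (psnd cx P) -> th (pfst cx Q) (psnd cx Q).
  case; apply: matrix_th => //; first by rewrite mab.
  by rewrite cmeetC mab.
have Mc : is_cong B (clos_refl_trans B M).
  apply: clos_refl_trans_cong => [P Q [/matrix_sym h|/matrix_sym h]|].
  - by left.
  - by right.
  (* Changing one argument at a time lets both kinds of matrix occur in a chain. The fixed arguments
     need [matrix_refl], hence pairs in [be v th] or in [al v th]: this is why the pairs are taken
     in [x]. *)
  move=> f a b j ab [h|h]; [left | right]; apply: matrix_interp => i;
    by case: (eqVneq i j) => [->//|/ab ->]; apply: matrix_refl; case: (svalP (b i)).
pose diag y : B := mkpair cx (rx y).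
have dh : is_hom (diag : A -> B) by move=> f a; exact: pair_ext.
have dM y z : clos_refl_trans B M (diag y) (diag z).
  have cd := preimage_cong (diag : A -> B) _ dh Mc.
  have : cjoin A al be y z by rewrite jab.
  apply: (cjoin_min _ _ _ cd) => y' z' h; apply: rt_step; [left | right];
    exact: matrix_diag.
(* The operations send [diag u] to diagonal elements, all in its class by [dM], so the congruence is
   total. A chain from [diag u] to [(u, v)] then carries membership in [th] from [(u, u)] to
   [(u, v)]. *)
have tot := idempotent_class_total _ (diag u) (pair_in_variety cx E HA) Mc.
have {tot} : clos_refl_trans B M (diag u) (mkpair cx uv).
  apply: tot => f.
  have -> : interp B f (fun=> diag u) = diag (interp A f (fun=> u)).
    exact: pair_ext.
  exact: dM.
suff gen P Q : clos_refl_trans B M P Q ->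
    th (pfst cx P) (psnd cx P) -> th (pfst cx Q) (psnd cx Q).
  by move/gen; apply.
by elim=> [P' Q' /Mth//|//|P1 P2 P3 _ h1 _ h2 /h1/h2].
Qed.

Lemma Bcon_p_bullet (th a : crel A) : is_cong A th ->
  Bcon A a -> Bcon (quot A th) (p_bullet th a).
Proof.
move=> cth [ca [b [cb [jab mab]]]]; split; first exact: p_bullet_cong.
exists (p_bullet th b); split; first exact: p_bullet_cong.
split; first exact: p_bullet_cjoin_cnabla.
apply: quot_crel_ext => x y; split; last first.
  move/(cls_eq cth) => xy.
  by split; apply/(p_bulletE cth); exact: cjoinr.
case=> /(p_bulletE cth) h1 /(p_bulletE cth) h2; apply/(cls_eq cth).
exact: (complemented_cjoin_cmeet th ca cb cth jab mab _ _ (conj h1 h2)).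
Qed.

End Modular.

(** * Maximal congruences, the radical and injectivity *)

Lemma chain_finite_bound {T : Type} {I : finType} (F : crel T -> Prop)
    (a b : I -> T) :
    (exists m, F m) ->
    (forall m n, F m -> F n -> csubrel m n \/ csubrel n m) ->
    (forall i, exists2 m, F m & m (a i) (b i)) ->
  exists2 m, F m & forall i, m (a i) (b i).
Proof.
move=> [m0 F0] chF H.
suff [m Fm mP] : exists2 m, F m & forall i, i \in enum I -> m (a i) (b i).
  by exists m => // i; apply: mP; rewrite mem_enum.
elim: (enum I) => [|j s [m Fm mP]]; first by exists m0.
have [n Fn nj] := H j; case: (chF _ _ Fm Fn) => le.
  by exists n => // i; rewrite inE => /orP[/eqP->//|/mP/le].
by exists m => // i; rewrite inE => /orP[/eqP->|/mP//]; exact: le.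
Qed.

Section Radical.
Context {S : signature} {E : identity S -> Prop} (HSD : semidegenerate E).
Context {A : algebra S} (HA : in_variety E A).

(** Zorn's lemma on the proper congruences above [j]. Unions of chains are compatible because
    arities are finite, and proper because the signature is finite: the finitely many pairs that
    force totality would all lie in one member. *)
Lemma max_cong_exists (j : crel A) : is_cong A j -> j <> cnabla A ->
  exists2 m, max_cong A m & csubrel j m.
Proof.
move=> cj jn.
(* On an empty carrier [j] would be total. *)
have [e _] : exists e : A, True.
  apply: contrapT => none; apply: jn; apply: crel_ext => // x.
  by case: none; exists x.
have properP (t : crel A) : is_cong A t ->
    (forall f, t (interp A f (fun=> e)) e) -> t = cnabla A.
  move=> ct te; apply: crel_ext => // x y _.
  exact: (idempotent_class_total HSD _ e HA ct te).
pose U := {m : crel A | [/\ is_cong A m, m <> cnabla A & csubrel j m]}.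
pose R (m n : U) : bool := `[< csubrel (sval m) (sval n) >].
have j0 : [/\ is_cong A j, j <> cnabla A & csubrel j j] by split.
pose ju : U := exist _ j j0.
case: (@classical_sets.Zorn U R).
- by move=> t; apply/asboolP.
- by move=> r s t /asboolP rs /asboolP st; apply/asboolP => x y /rs/st.
- move=> [s Hs] [t Ht] /asboolP /= st /asboolP /= ts.
  by apply: eq_exist; exact: crel_ext.
- move=> C totC.
  (* Adding [j] to the chain keeps its union reflexive and above [j] even when [C] is empty. *)
  pose F (r : crel A) := exists2 m : U, m = ju \/ C m & r = sval m.
  have F0 : exists r, F r by exists j; exists ju => //; left.
  have cF r : F r -> is_cong A r by case=> m _ ->; case: (svalP m).
  have chF r s : F r -> F s -> csubrel r s \/ csubrel s r.
    move=> [m Hm ->] [n Hn ->]; case: Hm => [->|Cm].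
      by left; case: (svalP n).
    case: Hn => [->|Cn]; first by right; case: (svalP m).
    by case: (totC _ _ Cm Cn) => /asboolP; [left | right].
  pose u : crel A := fun x y => exists2 r, F r & r x y.
  have cu : is_cong A u.
    split.
    - by move=> x; have [r Fr] := F0; exists r => //; case: (cF _ Fr).
    - by move=> x y [r Fr xy]; exists r => //; case: (cF _ Fr) => _ sy _ _; exact: sy.
    - move=> x y z [r Fr xy] [s Fs yz].
      case: (chF _ _ Fr Fs) => le.
        by exists s => //; case: (cF _ Fs) => _ _ tr _; exact: tr (le _ _ xy) yz.
      by exists r => //; case: (cF _ Fr) => _ _ tr _; exact: tr xy (le _ _ yz).
    - move=> f a b /(chain_finite_bound _ _ _ F0 chF)[m Fm mab].
      by exists m => //; case: (cF _ Fm) => _ _ _; apply.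
  have un : u <> cnabla A.
    move=> ue.
    have H (f : op_sym S) : exists2 m, F m & m (interp A f (fun=> e)) e.
      by have : u (interp A f (fun=> e)) e by rewrite ue.
    have [m Fm me] := chain_finite_bound F _ (fun=> e) F0 chF H.
    have := properP _ (cF _ Fm) me.
    by case: Fm => n _ ->; case: (svalP n).
  have ju' : csubrel j u by move=> x y xy; exists j => //; exists ju => //; left.
  have u0 : [/\ is_cong A u, u <> cnabla A & csubrel j u] by split.
  exists (exist _ u u0) => s Cs; apply/asboolP => x y xy /=.
  by exists (sval s) => //; exists s => //; right.
- move=> [m [cm mn jm]] mmax; exists m => //; split=> // b cb mb.
  case: (pselect (b = cnabla A)) => [->|bn]; [by right | left].
  have b0 : [/\ is_cong A b, b <> cnabla A & csubrel j b].
    by split=> // x y /jm/mb.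
  have /= := mmax (exist _ b b0); rewrite /R asboolT // => /(_ isT).
  by case.
Qed.

(** If [a] were proper, a maximal congruence above it would also contain [th], hence the join. *)
Lemma cjoin_Rad_cnabla (a th : crel A) : is_cong A a -> csubrel th (Rad A) ->
  cjoin A a th = cnabla A -> a = cnabla A.
Proof.
move=> ca thR jn; apply: contrapT => an.
have [m mm am] := max_cong_exists a ca an.
case: (mm) => cm mn _; apply: mn; apply: crel_ext => // x y.
rewrite -jn; apply: cjoin_min => // u v /thR; exact.
Qed.

Context (HCM : cm_variety E).

Lemma Bcon_cjoin_le (th a b : crel A) : csubrel th (Rad A) ->
  Bcon A a -> Bcon A b -> csubrel b (cjoin A a th) -> csubrel b a.
Proof.
move=> thR [ca _] [cb [b' [cb' [jb mb]]]] le.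
(* Joined with [th], [b' v a] contains [b'] and [b], so it is total; the radical hypothesis then
   removes [th]. *)
have jn : cjoin A b' a = cnabla A.
  apply: (cjoin_Rad_cnabla _ th (cjoin_cong _ _) thR).
  apply: crel_ext => // x y; rewrite -jb.
  have cj := cjoin_cong (cjoin A b' a) th.
  apply: (cjoin_min _ _ _ cj) => u v.
    move/le; apply: (cjoin_min _ _ _ cj) => p q h; last exact: cjoinr.
    by apply: cjoinl; exact: cjoinr.
  by move=> h; apply: cjoinl; exact: cjoinl.
move=> x y xy.
(* Here [a] takes the place of [th]: [(b v a) ^ (b' v a)] is below [a], and its second factor is
   total. *)
apply: (complemented_cjoin_cmeet HCM HA HSD a cb cb' ca jb mb).
by split; [exact: cjoinl | rewrite jn].
Qed.

Lemma p_bullet_Bcon_inj (th a b : crel A) :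
    is_cong A th -> csubrel th (Rad A) -> Bcon A a -> Bcon A b ->
  p_bullet th a = p_bullet th b -> a = b.
Proof.
move=> cth thR Ba Bb /(p_bullet_inj_cjoin cth) e; apply: crel_ext.
  by apply: (Bcon_cjoin_le th) => //; rewrite -e; exact: cjoinl.
by apply: (Bcon_cjoin_le th) => //; rewrite e; exact: cjoinl.
Qed.

End Radical.

(** * Lifting sets of atoms *)

Theorem theorem7p4 (S : signature) (E : identity S -> Prop)
  (HCM : cm_variety E) (HSD : semidegenerate E) (HK : compact_comm_closed E)
  (A : algebra S) (HA : in_variety E A)
  (th : crel A) (Hth : is_cong A th) (Hrad : csubrel th (Rad A))
  (Hcblp : CBLP A th)
  (Om' : crel (quot A th) -> Prop)
  (HOm' : forall b, Om' b -> B_atom (quot A th) b) :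
  exists Om : crel A -> Prop,
    (forall a, Om a -> Bcon A a) /\ lifts A th Om Om' /\
    (forall Om2 : crel A -> Prop, (forall a, Om2 a -> Bcon A a) ->
        lifts A th Om2 Om' -> forall a, Om2 a <-> Om a) /\
    (forall a, Om a -> B_atom A a).
Proof.
have inj a b := p_bullet_Bcon_inj HSD HA HCM th a b Hth Hrad.
(* Injectivity forces this choice: the full preimage of [Om'] among complemented congruences. [CBLP]
   makes it reach all of [Om']. *)
exists (fun a => Bcon A a /\ Om' (p_bullet th a)); split; first by move=> a [].
split; [move=> b; split=> [Ob|[a [[_ Oa] <-]]//] | split].
- have [Bb _ _] := HOm' _ Ob; have [a [Ba e]] := Hcblp _ Bb.
  by exists a; rewrite e.
- move=> Om2 BOm2 lift2 a; split=> [Oa|[Ba /lift2[a' [Oa' e]]]].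
    by split; [exact: BOm2 | apply/lift2; exists a].
  by rewrite -(inj _ _ (BOm2 _ Oa') Ba e).
- move=> a [Ba /HOm'[_ nz atom]]; split=> //.
    by move=> ad; apply: nz; rewrite ad; exact: p_bullet_cdelta.
  move=> b Bb ba.
  (* The image of [b] is complemented and below an atom, so it is trivial or equal to that atom;
     injectivity transfers either case back to [b]. *)
  have [] := atom _ (Bcon_p_bullet HCM HA HSD _ _ Hth Bb) (p_bullet_mono Hth _ _ ba).
    rewrite -(p_bullet_cdelta Hth) => e; left.
    exact: (inj _ _ Bb Bcon_cdelta e).
  by move=> e; right; exact: (inj _ _ Bb Ba e).
Qed.
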